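(* Let $n\ge 1$ and consider a time-homogeneous discrete-time Markov chain with states $1,2,\dots,n$ and one-step transition probabilities $p_{ij}$. For states $i,j$, let $\psi_{ij}(z)$ be the probability generating function of the first passage time $X_{ij}$ from $i$ to $j$. Then for all states $i,j\in\{1,\dots,n\}$, $$\psi_{ij}(z)=p_{ij}z+\sum_{k:\,k\neq j}p_{ik}\,z\,\psi_{kj}(z),$$ where the sum is over all states $k\in\{1,\dots,n\}$ with $k\ne j$.
   Context: Let $(S_m)_{m\ge 0}$ be the Markov chain. For states $i,j$, the first passage time $X_{ij}$ is the number of steps needed to move from state $i$ to state $j$ for the first time, i.e. given $S_0=i$, $X_{ij}=\min\{m\ge 1: S_m=j\}$ (with $X_{ij}=\infty$ if there is no such $m$); in particular $X_{jj}$ is the first return time to $j$. The first passage probabilities are $f_{ij}(k)=P(X_{ij}=k)$ for $k=1,2,\dots$. The probability generating function of $X_{ij}$ is $\psi_{ij}(z)=\sum_{k=1}^{\infty} f_{ij}(k)z^k$; identities between generating functions are understood as identities of formal power series in $z$ (equivalently, for all real $z$ with $|z|<1$). *)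

(* Defs.v *)
From HB Require Import structures.
From mathcomp Require Import all_boot all_order all_algebra.
From mathcomp Require Import all_classical all_reals all_analysis.

Set Implicit Arguments.
Unset Strict Implicit.
Unset Printing Implicit Defensive.

Import Order.TTheory GRing.Theory Num.Theory.
Import numFieldNormedType.Exports.

Local Open Scope classical_set_scope.
Local Open Scope ring_scope.

Section MarkovChain.
Context {d : measure_display} {T : measurableType d} {R : realType} {n : nat}.
Implicit Types (P : probability T R) (S : nat -> T -> 'I_n) (p : 'M[R]_n).

(* Only meaningful when P B != 0, which every use below guarantees (in the
   Markov property, because the history is contained in {S m = x m}). *)
Definition cond_prob P (A B : set T) : R := fine (P (A `&` B)) / fine (P B).

Definition history S (m : nat) (x : nat -> 'I_n) : set T :=
  [set w | forall l, (l <= m)%N -> S l w = x l].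

Definition markov_property P S : Prop :=
  forall (m : nat) (x : nat -> 'I_n) (b : 'I_n),
    P (history S m x) != 0%E ->
    cond_prob P [set w | S m.+1 w = b] (history S m x) =
    cond_prob P [set w | S m.+1 w = b] [set w | S m w = x m].

Definition one_step_transitions P S p : Prop :=
  forall (m : nat) (a b : 'I_n),
    P [set w | S m w = a] != 0%E ->
    cond_prob P [set w | S m.+1 w = b] [set w | S m w = a] = p a b.

Record markov_chain P S p : Prop := MarkovChain {
  markov_chain_measurable :
    forall (m : nat) (a : 'I_n), measurable [set w | S m w = a];
  markov_chain_markov : markov_property P S;
  markov_chain_homogeneous : one_step_transitions P S p }.

(* The first m >= 1 with S m w = j; None stands for infinity. *)
Definition first_passage_time S (j : 'I_n) (w : T) : option nat :=
  if pselect (exists m, (0 < m)%N && (S m w == j)) is left e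
  then Some (ex_minn e) else None.

(* [P i] is the law of the chain given S 0 = i, so the dependence of X_ij
   on i lies in the measure. *)
Definition first_passage_prob (P : 'I_n -> probability T R) S
    (i j : 'I_n) (k : nat) : R :=
  fine (P i [set w | first_passage_time S j w = Some k]).

Definition first_passage_pgf (P : 'I_n -> probability T R) S
    (i j : 'I_n) (z : R) : R :=
  limn (fun N => \sum_(1 <= k < N) first_passage_prob P S i j k * z ^+ k).

End MarkovChain.

(* Main.v *)
(* Conditioning on the first m+1 states, the probability of first reaching j
   exactly k+1 steps after time m depends only on the state at time m, and
   obeys the one-step recursion
   f_ij(k+2) = \sum_(b != j) p_ib f_bj(k+1), with f_ij(1) = p_ij. Multiplying
   by z^(k+2) and summing gives the identity; the series converge by comparison
   with the geometric series. *)
Require Import Defs.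
From HB Require Import structures.
From mathcomp Require Import all_boot all_order all_algebra.
From mathcomp Require Import all_classical all_reals all_analysis.
From mathcomp Require Import ring.

Import Order.TTheory GRing.Theory Num.Theory.
Import numFieldNormedType.Exports.

Local Open Scope classical_set_scope.
Local Open Scope ring_scope.

Section MarkovChainTheory.
Set Implicit Arguments.
Unset Strict Implicit.
Context {d : measure_display} {T : measurableType d} {R : realType} {n : nat}.
Implicit Types (P : probability T R) (S : nat -> T -> 'I_n) (p : 'M[R]_n).

Lemma fine_probabilityK P (A : set T) : measurable A -> (fine (P A))%:E = P A.
Proof. by move=> mA; rewrite fineK// fin_num_measure. Qed.

Lemma fine_probability_ge0 P (A : set T) : 0 <= fine (P A).
Proof. exact: fine_ge0. Qed.

Lemma fine_probability_le1 P (A : set T) : measurable A -> fine (P A) <= 1.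
Proof. by move=> mA; rewrite -lee_fin fine_probabilityK// probability_le1. Qed.

Lemma probability_setI_eq0 P (A B : set T) :
  measurable A -> measurable B -> P A = 0%E -> P (A `&` B) = 0%E.
Proof.
move=> mA mB PA0; apply/eqP; rewrite -measure_le0 -PA0.
by apply: le_measure; rewrite ?inE//; exact: measurableI.
Qed.

Lemma fine_probability_setI1 P (A B : set T) :
  measurable A -> measurable B -> P A = 1%E ->
  fine (P (A `&` B)) = fine (P B).
Proof.
move=> mA mB PA1.
have PC0 : P (~` A) = 0%E by rewrite probability_setC// PA1 subee.
rewrite [in RHS](_ : B = (A `&` B) `|` (~` A `&` B)); last first.
  by rewrite -setIUl setUv setTI.
rewrite measureU//; [|exact: measurableI| |].
- rewrite [X in (_ + X)%E]probability_setI_eq0 ?adde0//; exact: measurableC.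
- apply: measurableI => //; exact: measurableC.
- by rewrite -subset0 => w [[Aw _] [nAw _]].
Qed.

Lemma fine_probability_partition (I : finType) P (X : T -> I) (A : set T) :
  (forall b, measurable [set w | X w = b]) -> measurable A ->
  fine (P A) = \sum_b fine (P (A `&` [set w | X w = b])).
Proof.
move=> mX mA.
have mAX b : measurable (A `&` [set w | X w = b]) by exact: measurableI.
have AE : A = \bigcup_b (A `&` [set w | X w = b]).
  by apply/seteqP; split => [w Aw|w [b _ []//]]; exists (X w).
rewrite sum_fine => [|b _]; last exact: fin_num_measure.
rewrite [in LHS]AE measure_fin_bigcup//; last 2 first.
- exact: finite_finset.
- exact: (@trivIset_preimage1_in _ _ setT A X).
congr fine; rewrite [RHS]bigfs ?index_enum_uniq// => [|b _ /negP[]]; last exact: mem_index_enum.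
by apply: eq_fsbigl; apply/seteqP; split.
Qed.

(** Every index past [m] gets the value [b]; this is harmless, since [history S m.+1] reads only
    indices up to [m.+1]. *)
Definition path_snoc (m : nat) (x : nat -> 'I_n) (b : 'I_n) (l : nat) :=
  if (l <= m)%N then x l else b.

Lemma historyS S m x :
  history S m.+1 x = history S m x `&` [set w | S m.+1 w = x m.+1].
Proof.
apply/seteqP; split => w.
  by move=> h; split => [l lm|]; apply: h; rewrite // leqW.
by move=> [h Sm] l; rewrite leq_eqVlt ltnS => /predU1P[->//|]; exact: h.
Qed.

Lemma history_snoc S m x b :
  history S m.+1 (path_snoc m x b) =
  history S m x `&` [set w | S m.+1 w = b].
Proof.
rewrite historyS {2}/path_snoc ltnn; congr (_ `&` _).
by apply/seteqP; split => w h l lm; rewrite h// /path_snoc lm.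
Qed.

(** First visit to [j] after time [m], taking place at time [m + k.+1]. Peeling off the first step
    rather than the last makes the recursion run parallel to [taboo_prob]. *)
Fixpoint passage S (j : 'I_n) (m k : nat) : set T :=
  if k is k'.+1 then ~` [set w | S m.+1 w = j] `&` passage S j m.+1 k'
  else [set w | S m.+1 w = j].

Lemma passageP S j m k w :
  passage S j m k w <->
  S (m + k.+1)%N w = j /\ forall l, (l < k)%N -> S (m + l.+1)%N w != j.
Proof.
elim: k m => [|k IH] m /=.
  by rewrite addn1; split => [|[]].
split => [[/eqP nj /IH[Sj Sn]]|[Sj Sn]].
- split=> [|[_|l lk]]; first by rewrite addnS -addSn.
    by rewrite addn1.
  by rewrite addnS -addSn Sn.
- split; first by apply/eqP; rewrite -addn1 Sn.
  apply/IH; split=> [|l lk]; first by rewrite addSn -addnS.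
  by rewrite addSn -addnS Sn.
Qed.

Lemma first_passage_timeE S j k :
  [set w | first_passage_time S j w = Some k.+1] = passage S j 0 k.
Proof.
apply/seteqP; split => w.
- rewrite /= /first_passage_time; case: pselect => // e [].
  case: ex_minnP => m /andP[_ /eqP Sm] mmin mE; apply/passageP.
  rewrite add0n -mE; split=> // l lk; apply/negP => /eqP Sl.
  have := mmin l.+1; rewrite -[l.+1]add0n Sl eqxx mE => /(_ isT).
  by rewrite add0n ltnS leqNgt lk.
- move=> /passageP[]; rewrite add0n => Sk Sn.
  rewrite /= /first_passage_time; case: pselect => [e|[]]; last first.
    by exists k.+1; rewrite Sk eqxx.
  case: ex_minnP => -[//|m] /= /eqP Sm mmin; congr (Some _.+1).
  apply/eqP; rewrite eqn_leq -ltnS mmin ?Sk ?eqxx//= leqNgt.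
  by apply/negP => /Sn; rewrite add0n Sm eqxx.
Qed.

(** Total weight of the paths of [k.+1] steps from [a] to [j] that avoid [j] in between. It involves
    only [p], hence no initial law. *)
Fixpoint taboo_prob p (j : 'I_n) (k : nat) (a : 'I_n) : R :=
  if k is k'.+1 then \sum_(b < n | b != j) p a b * taboo_prob p j k' b
  else p a j.

Section Chain.
Variables (P : probability T R) (S : nat -> T -> 'I_n) (p : 'M[R]_n).
Hypothesis SP : markov_chain P S p.

Let mS m a : measurable [set w | S m w = a] := markov_chain_measurable SP m a.

Lemma measurable_history m x : measurable (history S m x).
Proof.
elim: m x => [|m IH] x.
  rewrite (_ : history _ _ _ = [set w | S 0%N w = x 0%N]) //.
  by apply/seteqP; split => [w h|w /= h [|]//]; exact: h.
by rewrite historyS; exact: measurableI.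
Qed.

Lemma measurable_passage j m k : measurable (passage S j m k).
Proof.
elim: k m => [|k IH] m //=.
by apply: measurableI => //; exact: measurableC.
Qed.

Lemma probability_history_snoc m x b :
  fine (P (history S m.+1 (path_snoc m x b))) =
  fine (P (history S m x)) * p (x m) b.
Proof.
rewrite history_snoc; have mh := measurable_history m x.
(* The Markov property is silent on null histories; there both sides vanish. *)
have [P0|PN0] := eqVneq (P (history S m x)) 0%E.
  by rewrite probability_setI_eq0// P0 mul0r.
have PS0 : P [set w | S m w = x m] != 0%E.
  apply: contra_neq PN0 => PS0; apply/eqP; rewrite -measure_le0 -PS0.
  by apply: le_measure; rewrite ?inE// => w; exact.
rewrite -(markov_chain_homogeneous SP b PS0) -(markov_chain_markov SP)//.
rewrite /cond_prob setIC mulrC divfK//.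
by rewrite fine_eq0// fin_num_measure.
Qed.

(** Induction on [k] with [m] and [x] general: split according to the state [b] at time [m.+1]. The
    case [b = j] is impossible, and any other [b] lengthens the history by one step. Keeping the
    whole history lets the Markov property apply at each step. *)
Lemma probability_history_passage j m k x :
  fine (P (history S m x `&` passage S j m k)) =
  fine (P (history S m x)) * taboo_prob p j k (x m).
Proof.
elim: k m x => [|k IH] m x /=.
  by rewrite -probability_history_snoc history_snoc.
have mh := measurable_history m x.
have mp := measurable_passage j m.+1 k.
rewrite (fine_probability_partition _ (X := S m.+1))//; last first.
  by apply: measurableI => //; apply: measurableI => //; exact: measurableC.
rewrite (bigD1 j)//= [X in fine (P X)](_ : _ = set0); last first.
  by rewrite -subset0 => w [[_ [nj _]] /= Sj].
rewrite measure0 add0r big_distrr/=; apply: eq_bigr => b bj.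
rewrite mulrA -probability_history_snoc.
have -> : taboo_prob p j k b = taboo_prob p j k (path_snoc m x b m.+1).
  by rewrite /path_snoc ltnn.
rewrite -IH history_snoc; congr (fine (P _)).
apply/seteqP; split => w /=; first by move=> [[? [_ ?]] ?].
move=> [[hw Sb] pw]; split => //; split => //; split => //.
by rewrite Sb; exact/eqP.
Qed.

End Chain.

Section FirstPassage.
Variables (P : 'I_n -> probability T R) (S : nat -> T -> 'I_n) (p : 'M[R]_n).
Hypothesis S_start : forall i, P i [set w | S 0%N w = i] = 1%E.
Hypothesis S_chain : forall i, markov_chain (P i) S p.

(** Under [P i] the history of length zero is the almost sure event that the chain starts at [i], so
    it drops out of the intersection. *)
Lemma first_passage_prob_taboo i j k :
  first_passage_prob P S i j k.+1 = taboo_prob p j k i.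
Proof.
rewrite /first_passage_prob first_passage_timeE.
have hE : history S 0 (fun=> i) = [set w | S 0%N w = i].
  by apply/seteqP; split => [w h|w /= h [|]//]; exact: h.
have mp := measurable_passage (S_chain i) j 0 k.
have mS := markov_chain_measurable (S_chain i) 0 i.
have := probability_history_passage (S_chain i) j 0 k (fun=> i).
by rewrite hE S_start mul1r fine_probability_setI1.
Qed.

Lemma first_passage_prob1 i j : first_passage_prob P S i j 1 = p i j.
Proof. by rewrite first_passage_prob_taboo. Qed.

(** The two sides involve different measures, [P i] and [P b]; they are compared through
    [taboo_prob], which depends on [p] alone. *)
Lemma first_passage_probSS i j k :
  first_passage_prob P S i j k.+2 =
  \sum_(b < n | b != j) p i b * first_passage_prob P S b j k.+1.
Proof.
rewrite first_passage_prob_taboo; apply: eq_bigr => b _.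
by rewrite first_passage_prob_taboo.
Qed.

(** Shows that the [limn] defining the generating function is a genuine limit and not a default
    value. *)
Lemma first_passage_pgf_cvg i j (z : R) : `|z| < 1 ->
  (fun N => \sum_(1 <= k < N) first_passage_prob P S i j k * z ^+ k) @ \oo -->
  first_passage_pgf P S i j z.
Proof.
move=> z1.
pose u k := first_passage_prob P S i j k.+1 * z ^+ k.+1.
have cu : cvgn (series u).
  apply: normed_cvg.
  apply: series_le_cvg (is_cvg_geometric_series (a := 1) (z := `|z|) _).
  - by move=> k; exact: normr_ge0.
  - by move=> k; rewrite /= mul1r exprn_ge0.
  - move=> k; rewrite /= mul1r normrM normrX ger0_norm ?fine_probability_ge0//.
    (* One factor [|z|] is absorbed with the probability into a number at most 1, leaving the
       geometric term [|z| ^+ k]. *)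
    rewrite exprS mulrA ler_piMl ?exprn_ge0// mulr_ile1 ?fine_probability_ge0//.
      rewrite /first_passage_prob first_passage_timeE fine_probability_le1//.
      exact: (measurable_passage (S_chain i)).
    exact: ltW.
  - by rewrite normr_id.
apply/cvg_ex; exists (limn (series u)); rewrite -cvg_shiftS.
rewrite (_ : [sequence _]_N = series u)//.
by apply/funext => N; rewrite /= big_add1.
Qed.

End FirstPassage.

End MarkovChainTheory.

Theorem theorem2p1 (R : realType) (d : measure_display) (T : measurableType d)
    (n : nat) (n_ge1 : (1 <= n)%N) (p : 'M[R]_n)
    (S : nat -> T -> 'I_n) (P : 'I_n -> probability T R)
    (S_start : forall i : 'I_n, P i [set w | S 0%N w = i] = 1%E)
    (S_chain : forall i : 'I_n, markov_chain (P i) S p)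
    (i j : 'I_n) (z : R) (z_lt1 : `|z| < 1) :
  first_passage_pgf P S i j z =
  p i j * z + \sum_(k < n | k != j) p i k * z * first_passage_pgf P S k j z.
Proof.
have pgf_cvg a := first_passage_pgf_cvg S_chain (i := a) (j := j) z_lt1.
(* Shifting twice makes the upper bound [N.+2], so the term at 1 can be split off and the rest
   reindexed to end at [N.+1]. *)
apply/cvg_lim => //; rewrite -cvg_shiftS -cvg_shiftS.
under eq_cvg => N.
  rewrite /= big_ltn// (first_passage_prob1 S_start S_chain) expr1 big_add1.
  have -> : \sum_(1 <= k < N.+1) first_passage_prob P S i j k.+1 * z ^+ k.+1 =
      \sum_(a < n | a != j) p i a * z *
        \sum_(1 <= k < N.+1) first_passage_prob P S a j k * z ^+ k.
    under [RHS]eq_bigr do rewrite big_distrr.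
    (* The lower bound 1 rules out index 0, so the recursion at [k.+2] applies. *)
    rewrite exchange_big; apply: eq_big_nat => -[//|k] _.
    rewrite (first_passage_probSS S_start S_chain) big_distrl.
    by apply: eq_bigr => a _; rewrite exprS /=; ring.
  over.
apply: cvgD; first exact: cvg_cst.
apply: cvg_big => [|a _]; first exact: add_continuous.
(* The inner sums still end at [N.+1]; undoing one shift gives the known limit. *)
by apply: cvgMl_tmp; rewrite (cvg_shiftS (fun N => \sum_(1 <= k < N) _)).
Qed.
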